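(* Suppose that Assumption 1 (stated in the context) holds. Let $\mu$ be a constant with $0<\mu<1$, let $A>2\sqrt{2}/\mu$ be a constant, and let $(\widehat\alpha,\widehat\tau)$ be the Lasso estimator with tuning parameter $$\lambda=A\sigma\Big(\frac{\log 3M}{n r_n}\Big)^{1/2}.$$ Then, with probability at least $1-(3M)^{1-A^2\mu^2/8}$, $$\big\Vert \widehat f-f_0\big\Vert_n\le K_1\sqrt{\lambda\,\mathcal M(\alpha_0)},\qquad\text{where } K_1:=\sqrt{2C_1C_2(3+\mu)}>0 .$$
   Context: Model. Let $n,M\ge 1$ be integers. For $i=1,\dots,n$ let $X_i\in\mathbb R^M$ be deterministic vectors with entries $X_i^{(j)}$, let $Q_i\in\mathbb R$ be deterministic scalars, and let $U_1,\dots,U_n$ be independent $N(0,\sigma^2)$ random variables, $\sigma>0$. The observations satisfy $Y_i=X_i'\beta_0+X_i'\delta_0 1\{Q_i<\tau_0\}+U_i$, with $\beta_0,\delta_0\in\mathbb R^M$, $\tau_0\in\mathbb R$; put $\alpha_0=(\beta_0',\delta_0')'\in\mathbb R^{2M}$. Notation. $|a|_p$ is the $\ell_p$ norm of a vector $a$; $J(a)=\{j:a_j\ne0\}$ and $\mathcal M(a)=|J(a)|$ is the number of nonzero entries. For $W\in\mathbb R^n$, $\Vert W\Vert_n=(n^{-1}\sum_{i=1}^n W_i^2)^{1/2}$. $\mathbf X_i(\tau)=(X_i',X_i'1\{Q_i<\tau\})'\in\mathbb R^{2M}$; $\mathbf X(\tau)$ is the $n\times 2M$ matrix with $i$-th row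 $\mathbf X_i(\tau)'$ and $j$-th column $\mathbf X^{(j)}(\tau)$. $X^{(j)}=(X_1^{(j)},\dots,X_n^{(j)})'$ and $X^{(j)}(\tau)=(X_1^{(j)}1\{Q_1<\tau\},\dots,X_n^{(j)}1\{Q_n<\tau\})'$ for $j=1,\dots,M$. $\mathbf D(\tau)=\mathrm{diag}\{\Vert\mathbf X^{(j)}(\tau)\Vert_n: j=1,\dots,2M\}$. Lasso estimator. Let $\mathcal A\subset\mathbb R^{2M}$ and $\mathbb T=[t_0,t_1]$ be the parameter spaces for $\alpha_0$ and $\tau_0$. With $S_n(\alpha,\tau)=n^{-1}\sum_{i=1}^n(Y_i-\mathbf X_i(\tau)'\alpha)^2$, the Lasso estimator $(\widehat\alpha,\widehat\tau)$, $\widehat\alpha=(\widehat\beta',\widehat\delta')'$, is a minimizer over $(\alpha,\tau)\in\mathcal A\times\mathbb T$ of $S_n(\alpha,\tau)+\lambda|\mathbf D(\tau)\alpha|_1$ (the minimizing set in $\tau$ is an interval, and $\widehat\tau$ is taken to be its maximum). Prediction risk. $\Vert\widehat f-f_0\Vert_n=\big(n^{-1}\sum_{i=1}^n(\widehat f(X_i,Q_i)-f_0(X_i,Q_i))^2\big)^{1/2}$, where $\widehat f(x,q)=x'\widehat\beta+x'\widehat\delta1\{q<\widehat\tau\}$ and $f_0(x,q)=x'\beta_0+x'\delta_01\{q<\tau_0\}$. $r_n:=\min_{1\le j\le M}\Vert X^{(j)}(t_0)\Vert_n^2/\Vert X^{(j)}\Vert_n^2$. Assumption 1. (i) Every $\alpha\in\mathcal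 A$, including $\alpha_0\in\mathcal A$, satisfies $\max_{j}|\alpha_j|\le C_1$ for some constant $C_1>0$; moreover $\tau_0\in\mathbb T=[t_0,t_1]$ with $\min_i Q_i<t_0<t_1<\max_i Q_i$. (ii) There are constants $C_2,C_3>0$ such that $\Vert\mathbf X^{(j)}(\tau)\Vert_n\le C_2$ for all $j=1,\dots,2M$ and $\tau\in\mathbb T$, and $\Vert\mathbf X^{(j)}(t_0)\Vert_n\ge C_3$ for all $j=1,\dots,2M$. (iii) There are no $i\ne j$ with $Q_i=Q_j$. *)

(* Defs.v *)
From HB Require Import structures.
From mathcomp Require Import all_boot all_order all_algebra.
From mathcomp Require Import all_classical all_reals all_analysis.

Set Implicit Arguments.
Unset Strict Implicit.
Unset Printing Implicit Defensive.

Import Order.TTheory GRing.Theory Num.Theory.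
Local Open Scope classical_set_scope.
Local Open Scope ring_scope.

Definition dotv (R : realType) (m : nat) (u v : 'cV[R]_m) : R :=
  \sum_(j < m) u j 0 * v j 0.

Definition l1norm (R : realType) (m : nat) (a : 'cV[R]_m) : R :=
  \sum_(j < m) `|a j 0|.

Definition nnz (R : realType) (m : nat) (a : 'cV[R]_m) : nat :=
  #|[set j : 'I_m | a j 0 != 0]%SET|.

Definition normn (R : realType) (n : nat) (W : 'I_n -> R) : R :=
  Num.sqrt (n%:R^-1 * \sum_(i < n) W i ^+ 2).

(* For a finite nonempty index type, the infimum and supremum of the range
   are the minimum and the maximum of the family. *)
Definition minf (R : realType) (I : finType) (F : I -> R) : R := inf (range F).

Definition maxf (R : realType) (I : finType) (F : I -> R) : R := sup (range F).

Section ThresholdModel.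
Context (R : realType) (n M : nat) (X : 'I_n -> 'cV[R]_M) (Q : 'I_n -> R).

(* alpha = (beta', delta')' is stored as col_mx beta delta. *)
Definition regfun (alpha : 'cV[R]_(M + M)) (tau : R) (x : 'cV[R]_M) (q : R) : R :=
  dotv x (usubmx alpha) + dotv x (dsubmx alpha) * (q < tau)%R%:R.

Definition Xb (tau : R) (i : 'I_n) : 'cV[R]_(M + M) :=
  col_mx (X i) ((Q i < tau)%R%:R *: X i).

Definition colXb (tau : R) (j : 'I_(M + M)) : 'I_n -> R :=
  fun i => Xb tau i j 0.

Definition colX (j : 'I_M) : 'I_n -> R := fun i => X i j 0.

Definition colXtau (tau : R) (j : 'I_M) : 'I_n -> R :=
  fun i => X i j 0 * (Q i < tau)%R%:R.

Definition Dmat (tau : R) : 'M[R]_(M + M) :=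
  diag_mx (\row_(j < M + M) normn (colXb tau j)).

Definition rn (t0 : R) : R :=
  minf (fun j : 'I_M => normn (colXtau t0 j) ^+ 2 / normn (colX j) ^+ 2).

Definition Sn (y : 'I_n -> R) (alpha : 'cV[R]_(M + M)) (tau : R) : R :=
  n%:R^-1 * \sum_(i < n) (y i - dotv (Xb tau i) alpha) ^+ 2.

Definition lasso_obj (y : 'I_n -> R) (lambda : R)
    (alpha : 'cV[R]_(M + M)) (tau : R) : R :=
  Sn y alpha tau + lambda * l1norm (Dmat tau *m alpha).

Definition lasso_minimizer (y : 'I_n -> R) (calA : set 'cV[R]_(M + M))
    (t0 t1 lambda : R) (alpha : 'cV[R]_(M + M)) (tau : R) : Prop :=
  [/\ calA alpha, t0 <= tau <= t1 &
      forall (a : 'cV[R]_(M + M)) (t : R), calA a -> t0 <= t <= t1 ->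
        lasso_obj y lambda alpha tau <= lasso_obj y lambda a t].

(* The objective is constant in tau between consecutive values of Q, so a
   minimizing tau is not unique; the estimator uses the largest one. *)
Definition is_lasso (y : 'I_n -> R) (calA : set 'cV[R]_(M + M))
    (t0 t1 lambda : R) (alpha : 'cV[R]_(M + M)) (tau : R) : Prop :=
  lasso_minimizer y calA t0 t1 lambda alpha tau /\
  ubound [set t | exists a, lasso_minimizer y calA t0 t1 lambda a t] tau.

Record assumption1 (calA : set 'cV[R]_(M + M)) (alpha0 : 'cV[R]_(M + M))
    (tau0 t0 t1 C1 C2 C3 : R) : Prop := {
  as_C1_gt0 : 0 < C1;
  as_A_bounded : forall a, calA a -> forall j, `|a j 0| <= C1;
  as_alpha0 : calA alpha0;
  as_tau0 : t0 <= tau0 <= t1;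
  as_minQ : minf Q < t0;
  as_t0t1 : t0 < t1;
  as_maxQ : t1 < maxf Q;
  as_C2_gt0 : 0 < C2;
  as_C3_gt0 : 0 < C3;
  as_col_le : forall j tau, t0 <= tau <= t1 -> normn (colXb tau j) <= C2;
  as_col_ge : forall j, C3 <= normn (colXb t0 j);
  as_no_ties : forall i j, i != j -> Q i != Q j
}.

End ThresholdModel.

Section Prob.
Context (d : measure_display) (T : measurableType d) (R : realType)
  (P : probability T R).

Definition independent_rvs (n : nat) (U : 'I_n -> {RV P >-> R}) : Prop :=
  forall (J : {set 'I_n}) (B : 'I_n -> set R),
    (forall i, measurable (B i)) ->
    P (\bigcap_(i in [set` J]) (U i @^-1` B i)) =
    (\prod_(i in J) P (U i @^-1` B i))%E.

Definition has_normal_law (U : {RV P >-> R}) (m s : R) : Prop :=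
  forall B : set R, measurable B -> distribution P U B = normal_prob m s B.

(* E itself need not be measurable; when it is, this is p <= P E. *)
Definition with_prob_ge (p : R) (E : set T) : Prop :=
  exists F : set T, [/\ measurable F, F `<=` E & (p%:E <= P F)%E].

End Prob.

(* Main.v *)
(* Comparing the objective at (alphah, tauh) with its value at (alpha0, tau0)
   bounds the squared risk by (1 + mu) lambda |D(tau0) alpha0|_1 as soon as, for
   every column of Xb(tau) and every tau >= t0, the correlation with the noise is
   at most mu lambda / 2 times the norm of the column.

   Sorting the observations by Q turns the truncated sums, and also the full
   column sums, into partial sums of one sequence of independent Gaussian terms.
   Since exp(l S_k) is a submartingale, a Doob inequality bounds the probability
   that some partial sum exceeds x by exp(- x^2 / (2 Var S_n)); with both signs
   this costs 2 M events, each of probability at most (3 M)^(- A^2 mu^2 / 8). *)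

Require Import Defs.
From HB Require Import structures.
From mathcomp Require Import all_boot all_order all_algebra.
From mathcomp Require Import all_classical all_reals all_analysis.
From mathcomp Require Import measurable_realfun ring lra.
Import Order.TTheory GRing.Theory Num.Theory.
Local Open Scope classical_set_scope.
Local Open Scope ring_scope.

Set Implicit Arguments.
Unset Strict Implicit.
Unset Printing Implicit Defensive.

(** * Moment generating function of the centred Gaussian law *)

Lemma integral_normal_prob (R : realType) (m s : R) (f : R -> R) :
  measurable_fun setT f -> (forall x, 0 <= f x) ->
  (\int[normal_prob m s]_x (f x)%:E =
   \int[lebesgue_measure]_x (f x * normal_pdf m s x)%:E)%E.
Proof.
move=> mf f0; have dom := normal_prob_dominates m s.
have mfE : measurable_fun setT (EFin \o f) by exact/measurable_EFinP.
have mpdf : measurable_fun setT (EFin \o normal_pdf m s).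
  by apply/measurable_EFinP; exact: measurable_normal_pdf.
rewrite -(Radon_Nikodym_SigmaFinite.change_of_variables dom)//.
have h_int := Radon_Nikodym_SigmaFinite.f_integrable dom.
under [RHS]eq_integral do rewrite EFinM.
apply: ae_eq_integral => //.
- by apply: emeasurable_funM => //; exact: measurable_int h_int.
- exact: emeasurable_funM.
(* The Radon-Nikodym derivative and the density have the same integral over every measurable set,
   hence agree almost everywhere. *)
apply: ae_eqe_mul2l; apply: integral_ae_eq => // E _ mE.
by rewrite -Radon_Nikodym_SigmaFinite.f_integral.
Qed.

Lemma normal_prob_mgf (R : realType) (s c : R) : s != 0 ->
  (\int[normal_prob 0 s]_x (expR (c * x))%:E =
   (expR (c ^+ 2 * s ^+ 2 / 2))%:E)%E.
Proof.
move=> s0; rewrite integral_normal_prob; last 2 first.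
- by apply: measurableT_comp => //; exact: measurable_funM.
- by move=> x; exact: expR_ge0.
(* Completing the square: tilting the centred density by [expR (c * x)] moves its mean to
   [c * s ^+ 2], up to a constant factor. *)
transitivity (\int[@lebesgue_measure R]_x ((expR (c ^+ 2 * s ^+ 2 / 2))%:E *
    (normal_pdf (c * s ^+ 2) s x)%:E)%E)%E.
  apply: eq_integral => x _; rewrite -EFinM !normal_pdfE//; congr EFin.
  rewrite mulrCA [RHS]mulrCA; congr (_ * _).
  by rewrite /normal_fun -!expRD; congr expR; field.
rewrite ge0_integralZl//=.
- by rewrite integral_normal_pdf mule1.
- by apply/measurable_EFinP; exact: measurable_normal_pdf.
- by move=> x _; rewrite lee_fin normal_pdf_ge0.
Qed.

Lemma normal_law_mgf (d : measure_display) (T : measurableType d)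
    (R : realType) (P : probability T R) (X : {RV P >-> R}) (s c : R) :
  s != 0 -> has_normal_law X 0 s ->
  (\int[P]_w (expR (c * X w))%:E = (expR (c ^+ 2 * s ^+ 2 / 2))%:E)%E.
Proof.
move=> s0 lawX; rewrite -normal_prob_mgf//.
(* normal_prob lives on measurableTypeR R, whose display is not that of R. *)
pose X' : T -> measurableTypeR R := X.
have mX' : measurable_fun setT X'.
  by move=> mT B mB; exact: (measurable_funPT X mT).
have mexp : measurable_fun [set: R] (fun x : R => (expR (c * x))%:E).
  by apply/measurable_EFinP; apply: measurableT_comp.
transitivity (\int[pushforward P X']_x (expR (c * x))%:E)%E.
  by rewrite (ge0_integral_pushforward mX').
by apply: eq_measure_integral => B mB _; exact: lawX.
Qed.

(** * Integrals of products under independence from a sigma-algebra *)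

Section IndependentSigmaAlgebra.
Context (d : measure_display) (T : measurableType d) (R : realType)
  (P : probability T R) (G : set (set T)) (X : {RV P >-> R}).
Hypothesis G_measurable : G `<=` measurable.
Hypothesis G_indep : forall E B, <<s G >> E -> measurable B ->
  P (E `&` X @^-1` B) = (P E * P (X @^-1` B))%E.

(** The same points under the smaller sigma-algebra generated by [G]: measurability on [TG]
    expresses dependence on that information only. *)
Let TG := g_sigma_algebraType G.
Let idG : T -> TG := id.

Let sigmaG_measurable E : <<s G >> E -> measurable E.
Proof. by apply: smallest_sub => //; exact: sigma_algebra_measurable. Qed.

Let measurable_idG : measurable_fun setT idG.
Proof. by move=> _ E mE; rewrite setTI; exact: sigmaG_measurable. Qed.

Let measurable_graph : measurable_fun setT (fun w => (idG w, X w)).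
Proof. exact: measurable_fun_pair. Qed.

(** The joint law of [idG] and [X] agrees with the product of the two laws on rectangles, which is
    [G_indep], hence everywhere; Tonelli then factors the integral. *)
Lemma ge0_integralM_indep (W : TG -> \bar R) (g : R -> \bar R) :
  measurable_fun setT W -> (forall w, (0 <= W w)%E) ->
  measurable_fun setT g -> (forall x, (0 <= g x)%E) ->
  (\int[P]_w (W w * g (X w)) = \int[P]_w W w * \int[P]_w g (X w))%E.
Proof.
move=> mW W0 mg g0.
pose mid := isMeasurableFun.Build _ _ _ _ idG measurable_idG.
pose idG' : {mfun T >-> TG} := HB.pack idG mid.
pose mgr := isMeasurableFun.Build _ _ _ _ _ measurable_graph.
pose gr : {mfun T >-> (TG * R)%type} := HB.pack (fun w => (idG w, X w)) mgr.
pose f (z : TG * R) := (W z.1 * g z.2)%E.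
have mf : measurable_fun setT f.
  by apply: emeasurable_funM; apply: measurableT_comp.
have f0 z : (0 <= f z)%E by exact: mule_ge0.
transitivity (\int[distribution P gr]_z f z)%E.
  by rewrite ge0_integral_distribution.
transitivity (\int[distribution P idG' \x distribution P X]_z f z)%E.
  apply: eq_measure_integral => A mA _; apply/esym.
  by apply: product_measure_unique => // E B mE mB; exact: G_indep.
rewrite fubini_tonelli1// /fubini_F /f /=.
under eq_integral do rewrite ge0_integralZl//.
rewrite ge0_integralZr//; last exact: integral_ge0.
by rewrite !ge0_integral_distribution.
Qed.

End IndependentSigmaAlgebra.

(** * Sigma-algebras generated by finitely many of the noise variables *)

Section IndependentVariables.
Context (d : measure_display) (T : measurableType d) (R : realType)
  (P : probability T R) (n : nat) (U : 'I_n -> {RV P >-> R}).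

(** A pi-system for the sigma-algebra of the [U i] with [i] in [J], on which [independent_rvs]
    applies directly. *)
Definition cylinders (J : {set 'I_n}) : set (set T) :=
  [set C | exists2 B : 'I_n -> set R, (forall i, measurable (B i)) &
     C = \bigcap_(i in [set` J]) (U i @^-1` B i)].

Lemma measurable_preimage_rv i (B : set R) :
  measurable B -> measurable (U i @^-1` B).
Proof. by move=> mB; rewrite -[_ @^-1` _]setTI; exact: measurable_funPT. Qed.

Lemma cylinders_measurable J : cylinders J `<=` measurable.
Proof.
move=> _ [B mB ->]; apply: fin_bigcap_measurable => [|i _].
  exact: finite_finset.
exact: measurable_preimage_rv.
Qed.

Lemma cylinders_setI J : setI_closed (cylinders J).
Proof.
move=> _ _ [B mB ->] [C mC ->]; exists (fun i => B i `&` C i).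
  by move=> i; exact: measurableI.
by rewrite -bigcapI.
Qed.

Lemma cylinders_setT J : cylinders J setT.
Proof. by exists (fun=> setT); rewrite ?bigcapT. Qed.

Lemma cylinders_preimage (J : {set 'I_n}) i (B : set R) :
  i \in J -> measurable B -> cylinders J (U i @^-1` B).
Proof.
move=> iJ mB; exists (fun k => if k == i then B else setT) => [k|].
  by case: ifP.
apply/seteqP; split => [w Bw k _ /=|w /(_ i iJ)]; last by rewrite eqxx.
by case: eqP => // ->.
Qed.

Hypothesis U_indep : independent_rvs U.

Lemma cylinders_indep (J : {set 'I_n}) i C (B : set R) :
  i \notin J -> cylinders J C -> measurable B ->
  P (C `&` U i @^-1` B) = (P C * P (U i @^-1` B))%E.
Proof.
move=> iJ [D mD ->] mB.
(* Overriding [D] at [i] makes the intersection a single cylinder over [i |: J], whose probability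
   factors. *)
pose D' k := if k == i then B else D k.
have mD' k : measurable (D' k) by rewrite /D'; case: ifP.
have D'J k : k \in J -> D' k = D k.
  by rewrite /D'; case: eqP => // ->; rewrite (negPf iJ).
have -> : \bigcap_(k in [set` J]) (U k @^-1` D k) `&` U i @^-1` B =
    \bigcap_(k in [set` (i |: J)%SET]) (U k @^-1` D' k).
  apply/seteqP; split => [w [DJ Bi] k /=|w D'w].
    rewrite in_setU1 /D'; case: eqP => [-> //|_ /= kJ]; exact: DJ.
  split => [k /= kJ|/=].
    by have := D'w k; rewrite /= D'J// in_setU1 kJ orbT; exact.
  by have := D'w i; rewrite /= /D' eqxx in_setU1 eqxx; exact.
rewrite !U_indep// big_setU1//= muleC /D' eqxx; congr (_ * _)%E.
by apply: eq_bigr => k kJ; rewrite -/(D' k) D'J.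
Qed.

(** As functions of [C], both sides are finite measures that agree on the pi-system of cylinders, so
    they agree on the sigma-algebra it generates. *)
Lemma sigma_cylinders_indep (J : {set 'I_n}) i C (B : set R) :
  i \notin J -> <<s cylinders J >> C -> measurable B ->
  P (C `&` U i @^-1` B) = (P C * P (U i @^-1` B))%E.
Proof.
move=> iJ sC mB; have mUB := measurable_preimage_rv i mB.
have p_ge0 : 0 <= fine (P (U i @^-1` B)) by exact: fine_ge0.
have pE : P (U i @^-1` B) = (NngNum p_ge0)%:num%:E.
  by rewrite /= fineK// fin_num_measure.
rewrite muleC pE; change (mrestr P mUB C = mscale (NngNum p_ge0) P C).
apply: (g_sigma_algebra_measure_unique (cylinders J) _ (fun=> setT)) sC.
- exact: cylinders_measurable.
- by move=> _; exact: cylinders_setT.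
- by rewrite bigcup_const.
- exact: cylinders_setI.
- move=> A cA; rewrite /= /mrestr /mscale -pE muleC.
  exact: cylinders_indep iJ cA mB.
- by move=> _; rewrite /= /mrestr setTI ltey_eq fin_num_measure.
Qed.

End IndependentVariables.

(** * Doob-type maximal inequality for weighted Gaussian partial sums *)

Section MaximalInequality.
Context (d : measure_display) (T : measurableType d) (R : realType)
  (P : probability T R) (n : nat) (U : 'I_n -> {RV P >-> R}) (sigma : R).
Hypothesis sigma_gt0 : 0 < sigma.
Hypothesis U_indep : independent_rvs U.
Hypothesis U_normal : forall i, has_normal_law (U i) 0 sigma.
Implicit Types (l x : R) (c : 'I_n -> R) (s : seq 'I_n) (J : {set 'I_n}).

Definition psum c s (w : T) : R := \sum_(i <- s) c i * U i w.

(** The unbounded [k] is harmless, since [take k s] is [s] from [size s] on. *)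
Definition exceeds c s x : set T :=
  [set w | exists k, x < psum c (take k s) w].

Let cylT J := g_sigma_algebraType (cylinders U J).

Let sigma_cyl_measurable J (E : set T) :
  <<s cylinders U J >> E -> measurable E.
Proof.
apply: smallest_sub; first exact: sigma_algebra_measurable.
exact: cylinders_measurable.
Qed.

Let measurable_psum_cyl J c s : {subset s <= J} ->
  measurable_fun [set: cylT J] (psum c s : cylT J -> R).
Proof.
elim: s => [_|i s IHs sJ].
  rewrite (_ : psum c [::] = cst 0)//.
  by apply/funext => w; rewrite /psum big_nil.
rewrite (_ : psum c (i :: s) = (fun w => c i * U i w + psum c s w)); last first.
  by apply/funext => w; rewrite /psum big_cons.
apply: measurable_funD.
  apply: measurable_funM => // _ B mB; rewrite setTI.
  by apply: sub_sigma_algebra; apply: cylinders_preimage; rewrite // sJ ?mem_head.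
by apply: IHs => j js; apply: sJ; rewrite in_cons js orbT.
Qed.

(** Adaptedness: the event is determined by the variables listed in [s], which makes it independent
    of any later increment. *)
Let exceeds_cyl J c s x : {subset s <= J} ->
  <<s cylinders U J >> (exceeds c s x).
Proof.
move=> sJ; rewrite (_ : exceeds c s x =
    \bigcup_k (psum c (take k s) @^-1` `]x, +oo[)); last first.
  apply/seteqP; split => w [k].
    by move=> xk; exists k => //=; rewrite in_itv/= xk.
  by move=> _ /=; rewrite in_itv/= andbT => xk; exists k.
apply: (@bigcupT_measurable _ (cylT J)) => k.
rewrite -[X in measurable X]setTI; apply: measurable_psum_cyl => //.
by move=> i /mem_take; exact: sJ.
Qed.

Let mem_cyl s : {subset s <= [set i in s]%SET}.
Proof. by move=> i; rewrite inE. Qed.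

Let measurable_psum c s : measurable_fun [set: T] (psum c s).
Proof.
move=> _ B mB; apply: sigma_cyl_measurable.
exact: (measurable_psum_cyl c (@mem_cyl s)).
Qed.

Lemma measurable_exceeds c s x : measurable (exceeds c s x).
Proof. by apply: sigma_cyl_measurable; apply: exceeds_cyl; exact: mem_cyl. Qed.

(** Independence of a fresh [U i] from the past [J], combined with the Gaussian moment generating
    function. *)
Let ge0_integralM_expR J i (W : cylT J -> \bar R) (a : R) : i \notin J ->
  measurable_fun setT W -> (forall w, (0 <= W w)%E) ->
  (\int[P]_w (W w * (expR (a * U i w))%:E) =
   \int[P]_w W w * (expR (a ^+ 2 * sigma ^+ 2 / 2))%:E)%E.
Proof.
move=> iJ mW W0.
rewrite -(@normal_law_mgf _ _ _ P (U i) sigma) ?gt_eqF//.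
apply: (@ge0_integralM_indep _ _ _ P (cylinders U J) (U i) _ _ W
  (fun u => (expR (a * u))%:E)) => //.
- exact: cylinders_measurable.
- by move=> E B sE mB; exact: (sigma_cylinders_indep U_indep iJ sE mB).
- by apply/measurable_EFinP; apply: measurableT_comp.
Qed.

Let psum_rcons c s i w : psum c (rcons s i) w = psum c s w + c i * U i w.
Proof. by rewrite /psum -cats1 big_cat big_seq1. Qed.

Let measurable_expR_psum J c s l : {subset s <= J} ->
  measurable_fun [set: cylT J] (fun w : cylT J => (expR (l * psum c s w))%:E).
Proof.
move=> sJ; apply/measurable_EFinP; apply: measurableT_comp => //.
by apply: measurable_funM => //; exact: measurable_psum_cyl.
Qed.

Let measurable_expR_psumT c s l (D : set T) :
  measurable_fun D (fun w : T => (expR (l * psum c s w))%:E).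
Proof.
apply: measurable_funTS; apply/measurable_EFinP; apply: measurableT_comp => //.
exact: measurable_funM.
Qed.

(** Peeling off the last index: [uniq s] makes it fresh with respect to the prefix, so its factor
    splits off. *)
Lemma psum_mgf c s l : uniq s ->
  (\int[P]_w (expR (l * psum c s w))%:E =
   (expR (l ^+ 2 * sigma ^+ 2 / 2 * \sum_(i <- s) c i ^+ 2))%:E)%E.
Proof.
elim/last_ind: s => [_|s i IHs].
  rewrite big_nil mulr0 expR0.
  under eq_integral do rewrite /psum big_nil mulr0 expR0.
  by rewrite integral_cst// mul1e; exact: probability_setT.
rewrite rcons_uniq => /andP[si us].
under eq_integral do rewrite psum_rcons mulrDr mulrA expRD EFinM.
rewrite (@ge0_integralM_expR [set j in s]%SET)//.
- rewrite IHs// -EFinM -expRD -cats1 big_cat big_seq1; congr (expR _)%:E.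
  by rewrite /=; field.
- by rewrite inE.
- exact: (measurable_expR_psum c l (@mem_cyl s)).
Qed.

(** First-passage decomposition: the level is passed before the last index, or there for the first
    time. The pieces are disjoint, so their integrals add. *)
Let exceeds_rcons c s i x : exceeds c (rcons s i) x =
  exceeds c s x `|`
  ([set w | x < psum c (rcons s i) w] `\` exceeds c s x).
Proof.
rewrite setUDr setDv setD0.
apply/seteqP; split => w.
  move=> [k]; have [ks|sk] := leqP k (size s).
    by rewrite -cats1 takel_cat// => xk; left; exists k.
  by rewrite take_oversize ?size_rcons// => xs; right.
move=> [[k xk]|xs]; last first.
  by exists (size s).+1; rewrite -(size_rcons s i) take_size.
have [ks|sk] := leqP k (size s).
  by exists k; rewrite -cats1 takel_cat.
exists (size s); rewrite -cats1 take_size_cat//.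
by rewrite take_oversize in xk; last exact: ltnW.
Qed.

(** Chernoff's bound restricted to [E]: there the integrand is at least [expR (l * x)]. *)
Let le_integral_exceed c s l x (E : set T) : 0 <= l -> measurable E ->
  E `<=` [set w | x < psum c s w] ->
  ((expR (l * x))%:E * P E <= \int[P]_(w in E) (expR (l * psum c s w))%:E)%E.
Proof.
move=> l0 mE sE; rewrite -integral_cst//; apply: ge0_le_integral => //.
- by move=> w _; rewrite lee_fin expR_ge0.
- by move=> w /sE /ltW xw; rewrite lee_fin ler_expR ler_wpM2l.
Qed.

(* exp(l S_k) is a submartingale along s, so on the event of having already
   exceeded x the later increments do not decrease its integral. *)
Let exceeds_submartingale c s l x : uniq s -> 0 <= l ->
  ((expR (l * x))%:E * P (exceeds c s x) <=
   \int[P]_(w in exceeds c s x) (expR (l * psum c s w))%:E)%E.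
Proof.
move=> + l0; elim/last_ind: s => [_|s i IHs].
  apply: le_integral_exceed => //; first exact: measurable_exceeds.
  by move=> w [].
rewrite rcons_uniq => /andP[si us].
have mF : measurable ([set w | x < psum c (rcons s i) w] `\` exceeds c s x).
  apply: measurableD; last exact: measurable_exceeds.
  rewrite (_ : [set w | _] = psum c (rcons s i) @^-1` `]x, +oo[); last first.
    by apply/seteqP; split => w /=; rewrite in_itv/= andbT.
  by rewrite -[X in measurable X]setTI; exact: measurable_psum.
have dis : [disjoint exceeds c s x &
    [set w | x < psum c (rcons s i) w] `\` exceeds c s x].
  by apply/disj_setPS => w [? []].
rewrite exceeds_rcons ge0_integral_setU//; last exact: measurable_exceeds.
rewrite measureU//; last 2 first.
- exact: measurable_exceeds.
- by move: dis; rewrite disj_set2E => /eqP.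
rewrite ge0_muleDr//; apply: leeD; last first.
  by apply: le_integral_exceed => // w [].
apply: (le_trans (IHs us)).
rewrite [leLHS]integral_mkcond [leRHS]integral_mkcond !epatch_indic.
(* [W] collects all that depends on the past, indicator included. The new factor splits off with
   mean [expR ((l * c i) ^+ 2 * sigma ^+ 2 / 2)], which is at least 1. *)
pose W w : \bar R := ((expR (l * psum c s w))%:E * (\1_(exceeds c s x) w)%:E)%E.
rewrite -/W.
rewrite [leRHS](_ : _ =
    \int[P]_w (W w * (expR ((l * c i) * U i w))%:E))%E; last first.
  apply: eq_integral => w _ /=; rewrite /W psum_rcons mulrDr mulrA expRD.
  by rewrite EFinM muleAC.
have W0 w : (0 <= W w)%E by rewrite mule_ge0// lee_fin expR_ge0.
rewrite (@ge0_integralM_expR [set j in s]%SET)//; last 2 first.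
- by rewrite inE.
- apply: emeasurable_funM; first exact: (measurable_expR_psum c l (@mem_cyl s)).
  apply/measurable_EFinP; apply: measurable_indic.
  by apply: exceeds_cyl; exact: mem_cyl.
apply: lee_pemulr; first exact: integral_ge0.
rewrite lee_fin -[leLHS]expR0 ler_expR.
by rewrite divr_ge0// mulr_ge0// sqr_ge0.
Qed.

Lemma exceeds_le c s x : uniq s -> 0 <= x ->
  0 < \sum_(i <- s) c i ^+ 2 ->
  (P (exceeds c s x) <=
   (expR (- (x ^+ 2 / (2 * sigma ^+ 2 * \sum_(i <- s) c i ^+ 2))))%:E)%E.
Proof.
move=> us x0 V0; set V := \sum_(i <- s) _ in V0 *.
(* This [l] minimises the Chernoff exponent [l ^+ 2 * sigma ^+ 2 * V / 2 - l * x]. *)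
pose l := x / (sigma ^+ 2 * V).
have l0 : 0 <= l by rewrite divr_ge0// mulr_ge0 ?sqr_ge0// ltW.
have := le_trans (exceeds_submartingale c x us l0)
  (ge0_subset_integral _ (measurable_exceeds c s x) measurableT
    (@measurable_expR_psumT c s l setT)
    (fun w _ => expR_ge0 _) (@subsetT _ _)).
rewrite psum_mgf// -/V.
rewrite -lee_pdivlMl ?expR_gt0//; move/le_trans; apply.
rewrite -EFinM lee_fin -expRN -expRD ler_expR le_eqVlt; apply/orP; left.
by apply/eqP; rewrite /l; field; rewrite !gt_eqF.
Qed.

End MaximalInequality.

(** * Deterministic oracle inequality for the penalised criterion *)

Section LassoOracle.
Context (R : realType) (n M : nat) (X : 'I_n -> 'cV[R]_M) (Q : 'I_n -> R).
Implicit Types (alpha : 'cV[R]_(M + M)) (tau : R) (u : 'I_n -> R).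

Lemma dotv_Xb alpha tau i :
  dotv (Xb X Q tau i) alpha = regfun alpha tau (X i) (Q i).
Proof.
rewrite /regfun /dotv big_split_ord/= mulr_suml; congr (_ + _).
  by apply: eq_bigr => j _; rewrite /Xb col_mxEu mxE.
by apply: eq_bigr => j _; rewrite /Xb col_mxEd !mxE -mulrA mulrC.
Qed.

Lemma l1norm_Dmat alpha tau :
  l1norm (Dmat X Q tau *m alpha) =
  \sum_(j < M + M) normn (colXb X Q tau j) * `|alpha j 0|.
Proof.
apply: eq_bigr => j _; rewrite /Dmat mul_diag_mx !mxE normrM ger0_norm//.
exact: sqrtr_ge0.
Qed.

Lemma l1norm_Dmat_ge0 alpha tau : 0 <= l1norm (Dmat X Q tau *m alpha).
Proof. by apply: sumr_ge0 => j _. Qed.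

Lemma l1norm_Dmat_le alpha tau (C1 C2 : R) :
  (forall j, `|alpha j 0| <= C1) ->
  (forall j, normn (colXb X Q tau j) <= C2) ->
  l1norm (Dmat X Q tau *m alpha) <= C1 * C2 * (nnz alpha)%:R.
Proof.
move=> aC1 DC2; rewrite l1norm_Dmat (bigID (fun j => alpha j 0 != 0))/=.
rewrite [X in _ + X]big1 ?addr0; last first.
  by move=> j /negPn/eqP ->; rewrite normr0 mulr0.
rewrite /nnz -sum1_card natr_sum mulr_sumr big_mkcond [leRHS]big_mkcond/=.
apply: ler_sum => j _; rewrite inE; case: ifP => // _.
by rewrite mulr1 mulrC ler_pM// sqrtr_ge0.
Qed.

(** Exchanging the sums gives a combination of column correlations with weights [alpha j 0], which
    is bounded one column at a time. *)
Lemma noise_dotv_le u alpha tau (b : R) :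
  (forall j, `|\sum_(i < n) u i * colXb X Q tau j i| <=
             b * normn (colXb X Q tau j)) ->
  `|\sum_(i < n) u i * dotv (Xb X Q tau i) alpha| <=
  b * l1norm (Dmat X Q tau *m alpha).
Proof.
move=> noise.
rewrite (_ : \sum_i _ = \sum_(j < M + M)
    alpha j 0 * \sum_(i < n) u i * colXb X Q tau j i); last first.
  under eq_bigr do rewrite mulr_sumr.
  rewrite exchange_big/=; apply: eq_bigr => j _.
  by rewrite mulr_sumr; apply: eq_bigr => i _; rewrite mulrA mulrC.
apply: (le_trans (ler_norm_sum _ _ _)).
rewrite l1norm_Dmat mulr_sumr; apply: ler_sum => j _.
by rewrite normrM mulrC mulrA ler_wpM2r.
Qed.

Lemma normn_ge0 (W : 'I_n -> R) : 0 <= normn W.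
Proof. exact: sqrtr_ge0. Qed.

Lemma normn_sqr (W : 'I_n -> R) :
  normn W ^+ 2 = n%:R^-1 * \sum_(i < n) W i ^+ 2.
Proof.
by rewrite sqr_sqrtr// mulr_ge0 ?invr_ge0// sumr_ge0// => i _; exact: sqr_ge0.
Qed.

Lemma lasso_oracle_inequality u (y : 'I_n -> R) (calA : set 'cV[R]_(M + M))
    (t0 t1 lambda mu : R) alpha tau alpha0 tau0 :
  (0 < n)%N -> 0 <= lambda -> mu < 1 ->
  (forall i, y i = dotv (Xb X Q tau0 i) alpha0 + u i) ->
  calA alpha0 -> t0 <= tau0 <= t1 ->
  (forall t j, t0 <= t <= t1 -> `|\sum_(i < n) u i * colXb X Q t j i| <=
     n%:R * (mu * lambda / 2) * normn (colXb X Q t j)) ->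
  lasso_minimizer X Q y calA t0 t1 lambda alpha tau ->
  normn (fun i => dotv (Xb X Q tau i) alpha - dotv (Xb X Q tau0 i) alpha0) ^+ 2
    <= (1 + mu) * lambda * l1norm (Dmat X Q tau0 *m alpha0).
Proof.
move=> n_gt0 l0 mu1 yE A0 tau0T noise [_ tauT /(_ _ _ A0 tau0T)].
(* The cross term is a difference, so the estimate enters through the upper side of its noise bound
   and the truth through the lower side. *)
have /ler_normlP[_] := noise_dotv_le alpha (fun j => noise _ j tauT).
have /ler_normlP[+ _] := noise_dotv_le alpha0 (fun j => noise _ j tau0T).
rewrite normn_sqr /lasso_obj /Sn.
set L := l1norm (Dmat X Q tau *m alpha); set L0 := l1norm _.
pose g i := dotv (Xb X Q tau i) alpha; pose h i := dotv (Xb X Q tau0 i) alpha0.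
rewrite -/(\sum_(i < n) u i * h i) -/(\sum_(i < n) u i * g i).
rewrite (_ : \sum_(i < n) (y i - dotv (Xb X Q tau i) alpha) ^+ 2 =
    \sum_(i < n) u i ^+ 2 - 2 * (\sum_(i < n) u i * g i)
    + 2 * (\sum_(i < n) u i * h i) + \sum_(i < n) (g i - h i) ^+ 2); last first.
  rewrite !mulr_sumr -sumrB -!big_split/=; apply: eq_bigr => i _.
  by rewrite yE -/(g i) -/(h i); ring.
rewrite (_ : \sum_(i < n) (y i - dotv (Xb X Q tau0 i) alpha0) ^+ 2 =
    \sum_(i < n) u i ^+ 2); last first.
  by apply: eq_bigr => i _; rewrite yE addrC addKr.
set D := \sum_(i < n) (g i - h i) ^+ 2; set S := \sum_(i < n) u i ^+ 2.
rewrite -/D; set a := \sum_(i < n) u i * g i; set b := \sum_(i < n) u i * h i.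
have n0 : 0 < n%:R :> R by rewrite ltr0n.
have nV : n%:R^-1 * n%:R = 1 :> R by rewrite mulVf// gt_eqF.
have nV0 : 0 <= n%:R^-1 :> R by rewrite invr_ge0 ltW.
have L_ge0 : 0 <= L := l1norm_Dmat_ge0 alpha tau.
move=> Hb /(ler_wpM2l nV0) Ha obj.
have {}Ha : n%:R^-1 * a <= mu * lambda / 2 * L.
  by rewrite (le_trans Ha)// !mulrA nV mul1r.
have {}Hb : - (n%:R^-1 * b) <= mu * lambda / 2 * L0.
  by rewrite -mulrN (le_trans (ler_wpM2l nV0 Hb))// !mulrA nV mul1r.
have : 0 <= (1 - mu) * (lambda * L) by rewrite mulr_ge0 ?mulr_ge0// subr_ge0 ltW.
move: obj Ha Hb; rewrite !(mulrDr n%:R^-1) mulrN !(mulrCA n%:R^-1 2).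
lra.
Qed.

End LassoOracle.

(** * Initial segments of sorted lists, and the union bound *)

Lemma filter_sorted_take (T : eqType) (e : rel T) (p : pred T) (s : seq T) :
  transitive e -> sorted e s -> (forall x y, e x y -> p y -> p x) ->
  [seq x <- s | p x] = take (count p s) s.
Proof.
move=> e_tr + p_down; elim: s => //= x s IHs xs.
case: ifP => px; first by rewrite /= -IHs// (path_sorted xs).
(* Once the head fails the downward-closed [p], every later element fails as well, so the selected
   prefix is empty. *)
have pN : all (predC p) s.
  apply/allP => y ys /=; apply/negP => /(p_down x); rewrite px.
  by move/allP: (order_path_min e_tr xs) => /(_ y ys) -> /(_ isT).
have c0 : count p s = 0%N.
  by apply/eqP; rewrite eqn0Ngt -has_count -all_predC.
by apply/eqP; rewrite c0 take0 -size_eq0 size_filter c0.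
Qed.

Lemma measure_bigsetU_le (d : measure_display) (T : measurableType d)
    (R : realType) (mu : {measure set T -> \bar R}) (I : finType)
    (F : I -> set T) (p : R) :
  (forall i, measurable (F i)) -> (forall i, (mu (F i) <= p%:E)%E) ->
  (mu (\big[setU/set0]_(i : I) F i) <= (#|I|%:R * p)%:E)%E.
Proof.
move=> mF Fp; rewrite mulr_natl -sumr_const -sumEFin.
(* Measurability travels with the bound, since subadditivity at each union asks for it. *)
suff [] : measurable (\big[setU/set0]_(i : I) F i) /\
    (mu (\big[setU/set0]_(i : I) F i) <= \sum_(i in I) p%:E)%E by [].
elim/big_ind2: _ => [|A a B b [mA Aa] [mB Bb]|i _]; last by split.
  by rewrite measure0.
split; first exact: measurableU.
by apply: (le_trans (measureU2 _ mA mB)); exact: leeD.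
Qed.

(** * Column norms and positivity of [rn] *)

Section ColumnNorms.
Context (R : realType) (n M : nat) (X : 'I_n -> 'cV[R]_M) (Q : 'I_n -> R).
Implicit Types (j : 'I_M) (t : R).

Lemma normn_le (V W : 'I_n -> R) :
  (forall i, `|V i| <= `|W i|) -> normn V <= normn W.
Proof.
move=> VW; apply: ler_wsqrtr; apply: ler_wpM2l; first by rewrite invr_ge0.
apply: ler_sum => i _.
rewrite -(real_normK (num_real (V i))) -(real_normK (num_real (W i))).
by rewrite lerXn2r ?nnegrE.
Qed.

Lemma colXb_lshift t j : colXb X Q t (lshift M j) = colX X j.
Proof. by apply/funext => i; rewrite /colXb /Xb col_mxEu. Qed.

Lemma colXb_rshift t j : colXb X Q t (rshift M j) = colXtau X Q t j.
Proof. by apply/funext => i; rewrite /colXb /Xb col_mxEd mxE mulrC. Qed.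

Lemma normn_colXtau_le t t' j : t <= t' ->
  normn (colXtau X Q t j) <= normn (colXtau X Q t' j).
Proof.
move=> tt'; apply: normn_le => i; rewrite /colXtau !normrM ler_wpM2l//.
have [Qt|_] := boolP (Q i < t); first by rewrite (lt_le_trans Qt tt').
by rewrite normr0.
Qed.

Lemma normn_colXtau_le_colX t j : normn (colXtau X Q t j) <= normn (colX X j).
Proof.
apply: normn_le => i; rewrite /colXtau normrM ler_piMr//.
by case: (Q i < t); rewrite ?normr1 ?normr0.
Qed.

Lemma rn_le t0 j :
  rn X Q t0 <= normn (colXtau X Q t0 j) ^+ 2 / normn (colX X j) ^+ 2.
Proof.
apply: ge_inf; last by exists j.
by exists 0 => _ [k _ <-]; rewrite divr_ge0// sqr_ge0.
Qed.

Lemma rn_gt0 t0 (C2 C3 : R) : (0 < M)%N -> 0 < C2 -> 0 < C3 ->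
  (forall j, C3 <= normn (colXtau X Q t0 j)) ->
  (forall j, normn (colX X j) <= C2) -> 0 < rn X Q t0.
Proof.
move=> M0 C20 C30 ge3 le2.
apply: (@lt_le_trans _ _ (C3 ^+ 2 / C2 ^+ 2)).
  by rewrite divr_gt0// exprn_gt0.
(* [M0] makes the range nonempty, so the infimum inherits the lower bound [C3 ^+ 2 / C2 ^+ 2] of the
   ratios. *)
apply: lb_le_inf; first by eexists; exists (Ordinal M0).
move=> _ [j _ <-].
have X0 : 0 < normn (colX X j).
  exact: lt_le_trans C30 (le_trans (ge3 j) (normn_colXtau_le_colX _ _)).
apply: ler_pM; rewrite ?invr_ge0 ?sqr_ge0//.
  by rewrite lerXn2r// nnegrE ?normn_ge0// ltW.
by rewrite lef_pV2 ?posrE ?exprn_gt0// lerXn2r// nnegrE ltW.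
Qed.

End ColumnNorms.

(** * Truncated sums as partial sums in the order of [Q] *)

Section SortedPartialSums.
Context (R : realType) (n : nat) (Q : 'I_n -> R).

Definition sort_by : seq 'I_n := sort (relpre Q <=%O) (enum 'I_n).

Lemma sort_by_uniq : uniq sort_by.
Proof. by rewrite sort_uniq enum_uniq. Qed.

Lemma big_sort_by (F : 'I_n -> R) (p : pred 'I_n) :
  \sum_(i <- sort_by | p i) F i = \sum_(i < n | p i) F i.
Proof.
rewrite (perm_big (enum 'I_n)) ?big_enum_cond//=.
by rewrite perm_sort.
Qed.

(** The indices with [Q i < t] form an initial segment of the sorted list. Uniformity over all real
    [t] thereby reduces to finitely many partial sums. *)
Lemma sum_lt_sort_by (F : 'I_n -> R) (t : R) :
  exists k, \sum_(i < n) F i * (Q i < t)%R%:R = \sum_(i <- take k sort_by) F i.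
Proof.
exists (count (fun i => Q i < t) sort_by).
rewrite -(@filter_sorted_take _ (relpre Q <=%O)); last 3 first.
- by move=> y x z /=; exact: le_trans.
- by apply: sort_sorted => x y; exact: le_total.
- by move=> x y /=; exact: le_lt_trans.
rewrite big_filter big_sort_by [RHS]big_mkcond.
by apply: eq_bigr => i _; case: (Q i < t); rewrite ?mulr1 ?mulr0.
Qed.

End SortedPartialSums.

(** * Calibration of [lambda] and the noise event *)

Lemma noise_exponent_ge (R : realType) (N sigma mu A L r a b : R) :
  0 < N -> 0 < sigma -> 0 <= L -> 0 < r -> 0 < b -> r <= a ^+ 2 / b ^+ 2 ->
  A ^+ 2 * mu ^+ 2 / 8 * L <=
  (N * (mu * (A * sigma * Num.sqrt (L / (N * r))) / 2) * a) ^+ 2 /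
    (2 * sigma ^+ 2 * (N * b ^+ 2)).
Proof.
move=> N0 s0 L0 r0 b0 rab.
rewrite !exprMn sqr_sqrtr; last by rewrite divr_ge0// mulr_ge0// ltW.
(* The last factor is at least 1 because [r] bounds the ratio of squared norms from below; the [rn]
   in [lambda] compensates for thresholds set with the norm [a] while the variance involves [b]. *)
rewrite [leRHS](_ : _ = (A ^+ 2 * mu ^+ 2 / 8 * L) * (r^-1 * (a ^+ 2 / b ^+ 2))).
  apply: ler_peMr.
    by rewrite mulr_ge0// divr_ge0// mulr_ge0 ?sqr_ge0.
  by rewrite mulrC ler_pdivlMr// mul1r.
by field; rewrite !gt_eqF.
Qed.

Lemma noise_event (R : realType) (d : measure_display) (T : measurableType d)
  (P : probability T R) (n M : nat) (X : 'I_n -> 'cV[R]_M) (Q : 'I_n -> R)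
  (sigma : R) (U : 'I_n -> {RV P >-> R}) (t0 mu A lambda : R) :
  (0 < n)%N -> (0 < M)%N -> 0 < sigma -> independent_rvs U ->
  (forall i, has_normal_law (U i) 0 sigma) ->
  0 < mu -> 0 < A ->
  (forall j, 0 < normn (colX X j)) -> 0 < rn X Q t0 ->
  lambda = A * sigma * Num.sqrt (ln (3 * M)%:R / (n%:R * rn X Q t0)) ->
  exists F : set T, [/\ measurable F,
    ((1 - (3 * M)%:R `^ (1 - A ^+ 2 * mu ^+ 2 / 8))%:E <= P F)%E &
    forall w t j, F w -> t0 <= t ->
      `|\sum_(i < n) U i w * colXb X Q t j i| <=
      n%:R * (mu * lambda / 2) * normn (colXb X Q t j)].
Proof.
move=> n_gt0 M_gt0 sigma_gt0 Uind Ulaw mu_gt0 A_gt0 colX_gt0 r_gt0 lambdaE.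
have N_gt0 : 0 < n%:R :> R by rewrite ltr0n.
have M3_gt0 : 0 < (3 * M)%:R :> R by rewrite ltr0n muln_gt0.
have L_ge0 : 0 <= ln (3 * M)%:R :> R by rewrite ln_ge0// ler1n muln_gt0.
have lambda_ge0 : 0 <= lambda.
  by rewrite lambdaE mulr_ge0 ?sqrtr_ge0// ltW// mulr_gt0.
have m_ge0 : 0 <= n%:R * (mu * lambda / 2) by rewrite !mulr_ge0// ltW.
set s := sort_by Q; set q := A ^+ 2 * mu ^+ 2 / 8.
(* The truncated norm at [t0] is the smallest over all [t >= t0] and is below the full column norm,
   so one threshold per column serves every case. *)
pose x j := n%:R * (mu * lambda / 2) * normn (colXtau X Q t0 j).
(* The boolean is the sign with which the j-th column enters. *)
pose c (k : 'I_M * bool) i : R := (-1) ^+ k.2 * X i k.1 0.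
pose B k := exceeds U (c k) s (x k.1).
pose p : R := expR (- (q * ln (3 * M)%:R)).
have x_ge0 j : 0 <= x j by rewrite mulr_ge0// normn_ge0.
have mB k : measurable (B k) by exact: measurable_exceeds.
have sumc k : \sum_(i <- s) c k i ^+ 2 = n%:R * normn (colX X k.1) ^+ 2.
  rewrite normn_sqr mulrA divff ?gt_eqF// mul1r big_sort_by.
  by apply: eq_bigr => i _; rewrite /c exprMn sqrr_sign mul1r.
have PB k : (P (B k) <= p%:E)%E.
  have V_gt0 : 0 < \sum_(i <- s) c k i ^+ 2.
    by rewrite sumc mulr_gt0// exprn_gt0.
  have := exceeds_le sigma_gt0 Uind Ulaw (sort_by_uniq Q) (x_ge0 k.1) V_gt0.
  move/le_trans; apply.
  rewrite lee_fin ler_expR lerN2 sumc /x lambdaE.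
  by apply: noise_exponent_ge => //; exact: rn_le.
exists (~` \big[setU/set0]_(k : 'I_M * bool) B k).
have mbigB : measurable (\big[setU/set0]_(k : 'I_M * bool) B k).
  exact: bigsetU_measurable.
split; first exact: measurableC.
- rewrite probability_setC// EFinB leeB//.
  apply: (le_trans (measure_bigsetU_le mB PB)).
  (* Bounding the count 2 M by 3 M absorbs it into the power with exponent [1 - q]. *)
  rewrite lee_fin card_prod card_ord card_bool /powR gt_eqF//.
  rewrite mulrBl mul1r expRD lnK ?posrE// ler_wpM2r ?expR_ge0//.
  by rewrite ler_nat mulnC leq_mul2r orbT.
move=> w t j Fw t0t.
have psumB k l : psum U (c k) (take l s) w <= x k.1.
  rewrite leNgt; apply/negP => xlt; apply: Fw.
  by rewrite (bigD1 k)//=; left; exists l.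
(* The two signs in [c] give the two sides of the absolute value. *)
have sum_le (j' : 'I_M) l :
    `|\sum_(i <- take l s) X i j' 0 * U i w| <= x j'.
  rewrite ler_norml lerNl -sumrN; apply/andP; split.
    rewrite (le_trans _ (psumB (j', true) l))// le_eqVlt; apply/orP; left.
    by apply/eqP; apply: eq_bigr => i _; rewrite /c expr1 mulN1r mulNr.
  rewrite (le_trans _ (psumB (j', false) l))// le_eqVlt; apply/orP; left.
  by apply/eqP; apply: eq_bigr => i _; rewrite /c expr0 mul1r.
rewrite -(fintype.splitK j); case: (fintype.split j) => k /=.
(* A full column sum is the partial sum of length [size s]. *)
- rewrite colXb_lshift; apply: (@le_trans _ _ (x k)); last first.
    by rewrite ler_wpM2l// normn_colXtau_le_colX.
  rewrite (_ : \sum_(i < n) _ = \sum_(i <- take (size s) s) X i k 0 * U i w)//.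
  by rewrite take_size big_sort_by; apply: eq_bigr => i _; rewrite mulrC.
- rewrite colXb_rshift; apply: (@le_trans _ _ (x k)); last first.
    by rewrite ler_wpM2l// normn_colXtau_le.
  have [l El] := sum_lt_sort_by Q (fun i => X i k 0 * U i w) t.
  rewrite (_ : \sum_(i < n) _ = \sum_(i <- take l s) X i k 0 * U i w)//.
  by rewrite -El; apply: eq_bigr => i _; rewrite /colXtau mulrA [U i w * _]mulrC.
Qed.

(** * From the noise event to the prediction risk bound *)

Theorem theorem1 (R : realType) (d : measure_display) (T : measurableType d)
  (P : probability T R) (n M : nat) (hn : (1 <= n)%N) (hM : (1 <= M)%N)
  (X : 'I_n -> 'cV[R]_M) (Q : 'I_n -> R)
  (sigma : R) (hsigma : 0 < sigma)
  (U : 'I_n -> {RV P >-> R})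
  (hUind : independent_rvs U)
  (hUlaw : forall i, has_normal_law (U i) 0 sigma)
  (beta0 delta0 : 'cV[R]_M) (tau0 : R)
  (Y : 'I_n -> T -> R)
  (hY : forall i w, Y i w =
     dotv (X i) beta0 + dotv (X i) delta0 * (Q i < tau0)%R%:R + U i w)
  (calA : set 'cV[R]_(M + M)) (t0 t1 C1 C2 C3 : R)
  (hA1 : assumption1 X Q calA (col_mx beta0 delta0) tau0 t0 t1 C1 C2 C3)
  (mu A : R) (hmu : 0 < mu < 1) (hA : 2 * Num.sqrt 2 / mu < A)
  (lambda : R)
  (hlambda : lambda =
     A * sigma * Num.sqrt (ln (3 * M)%:R / (n%:R * rn X Q t0)))
  (alphah : T -> 'cV[R]_(M + M)) (tauh : T -> R)
  (hlasso : forall w,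
     is_lasso X Q (fun i => Y i w) calA t0 t1 lambda (alphah w) (tauh w)) :
  let K1 := Num.sqrt (2 * C1 * C2 * (3 + mu)) in
  0 < K1 /\
  with_prob_ge P (1 - (3 * M)%:R `^ (1 - A ^+ 2 * mu ^+ 2 / 8))
    [set w | normn (fun i => regfun (alphah w) (tauh w) (X i) (Q i)
                           - regfun (col_mx beta0 delta0) tau0 (X i) (Q i))
             <= K1 * Num.sqrt (lambda * (nnz (col_mx beta0 delta0))%:R)].
Proof.
move=> K1.
have [mu_gt0 mu_lt1] := andP hmu.
have C1_gt0 := as_C1_gt0 hA1; have C2_gt0 := as_C2_gt0 hA1.
have A_gt0 : 0 < A.
  by rewrite (le_lt_trans _ hA)// divr_ge0 ?mulr_ge0 ?sqrtr_ge0// ltW.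
have K_gt0 : 0 < 2 * C1 * C2 * (3 + mu) by rewrite !mulr_gt0 ?addr_gt0.
split; first by rewrite sqrtr_gt0.
have tau0T := as_tau0 hA1.
have t0T : t0 <= t0 <= t1 by rewrite lexx ltW// (as_t0t1 hA1).
have colXtau_ge j : C3 <= normn (colXtau X Q t0 j).
  by rewrite -colXb_rshift; exact: (as_col_ge hA1).
have colX_le j : normn (colX X j) <= C2.
  by rewrite -(colXb_lshift X Q t0); exact: (as_col_le hA1).
have colX_gt0 j : 0 < normn (colX X j).
  apply: (lt_le_trans (as_C3_gt0 hA1)); apply: (le_trans (colXtau_ge j)).
  exact: normn_colXtau_le_colX.
have r_gt0 := rn_gt0 hM C2_gt0 (as_C3_gt0 hA1) colXtau_ge colX_le.
have [F [mF PF noise]] := noise_event hn hM hsigma hUind hUlaw mu_gt0 A_gt0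
  colX_gt0 r_gt0 hlambda.
have lambda_ge0 : 0 <= lambda.
  by rewrite hlambda mulr_ge0 ?sqrtr_ge0// ltW// mulr_gt0.
(* The measurable noise event [F] is the witness for [with_prob_ge]; the rest is deterministic at a
   fixed [w]. *)
exists F; split => // w Fw /=.
set alpha0 := col_mx beta0 delta0.
have [lasso_min _] := hlasso w.
have Yw i : Y i w = dotv (Xb X Q tau0 i) alpha0 + U i w.
  by rewrite hY dotv_Xb /regfun col_mxKu col_mxKd.
have := lasso_oracle_inequality hn lambda_ge0 mu_lt1 Yw (as_alpha0 hA1) tau0T
  (fun t j tT => noise w t j Fw (proj1 (andP tT))) lasso_min.
under [X in normn X]eq_fun do rewrite !dotv_Xb.
have nnz_le := l1norm_Dmat_le (as_A_bounded hA1 (as_alpha0 hA1))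
  (fun j => as_col_le hA1 j tau0T).
move=> oracle; rewrite /K1 -sqrtrM ?(ltW K_gt0)//.
rewrite -[normn _]ger0_norm ?normn_ge0//.
rewrite -sqrtr_sqr; apply: ler_wsqrtr; apply: (le_trans oracle).
have l1_ge0 : 0 <= (1 + mu) * lambda by rewrite mulr_ge0// addr_ge0// ltW.
apply: (le_trans (ler_wpM2l l1_ge0 nnz_le)).
have : 0 <= C1 * C2 * (lambda * (nnz alpha0)%:R).
  by rewrite !mulr_ge0// ltW.
rewrite -/alpha0; set z := (nnz alpha0)%:R => Cz_ge0.
(* With the common factor isolated, it remains to compare the oracle constant [1 + mu] with the
   larger [2 * (3 + mu)] coming from the square of [K1]. *)
rewrite [leLHS](_ : _ = (1 + mu) * (C1 * C2 * (lambda * z))); last by ring.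
rewrite [leRHS](_ : _ = (2 * (3 + mu)) * (C1 * C2 * (lambda * z))); last by ring.
by apply: ler_wpM2r => //; lra.
Qed.
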